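(* For almost all initial points $\tilde{x}^{(0)}\in\mathbb{R}^n$ with $\psi_i(\tilde{x}^{(0)})\neq 0$ for all $i\in\{1,\dots,n\}$, the following holds: if the Jacobian matrix $\frac{\partial\psi(\tilde{x}^{(0)})}{\partial\tilde{x}^{(0)}}$ of $\psi$ at $\tilde{x}^{(0)}$ is nonsingular, then $0$ is a regular value of the homotopy function $\mathcal{H}_{\tilde{x}^{(0)}}:\mathbb{R}^n\times(0,1]^n\to\mathbb{R}^n$, and the zero point set $$\mathcal{H}_{\tilde{x}^{(0)}}^{-1}(0)=\{(\tilde{x},\tilde{\lambda})\in\mathbb{R}^n\times(0,1]^n:\ \mathcal{H}_{\tilde{x}^{(0)}}(\tilde{x},\tilde{\lambda})=0\}$$ contains a smooth curve $\Gamma_{\tilde{x}^{(0)}}$ starting from $(\tilde{x}^{(0)},e)$.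
   Context: Let $f=(f_1,\dots,f_n)^T:\mathbb{R}^n\to\mathbb{R}^n$ be continuously differentiable, let $\phi(t)=t^3$, and define $\psi=(\psi_1,\dots,\psi_n)^T:\mathbb{R}^n\to\mathbb{R}^n$ by $$\psi_i(x)=\phi\big((f_i(x)-x_i)^2\big)-\phi\big(f_i(x)|f_i(x)|\big)-\phi\big(x_i|x_i|\big).$$ For an initial point $\tilde{x}^{(0)}\in\mathbb{R}^n$ and a vector parameter $\tilde{\lambda}=(\lambda_1,\dots,\lambda_n)^T$, the homotopy function is $$\mathcal{H}_{\tilde{x}^{(0)}}(\tilde{x},\tilde{\lambda})=\mathcal{H}(\tilde{x},\tilde{x}^{(0)},\tilde{\lambda})=\big(\psi_i(\tilde{x})-\lambda_i\,\psi_i(\tilde{x}^{(0)})\big)_{i=1}^n .$$ Here $e=(1,\dots,1)^T\in\mathbb{R}^n$. ''Almost all'' is with respect to Lebesgue measure. $0$ is a regular value of a map if the derivative of the map is surjective at every point of the preimage of $0$. A smooth curve starting from a point $q$ is the image of a continuously differentiable map $\gamma:[0,a)\to\mathbb{R}^n\times(0,1]^n$, $0<a\le\infty$, with $\gamma(0)=q$ and nowhere vanishing derivative. *)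

(* Defs.v *)
From HB Require Import structures.
From mathcomp Require Export all_boot all_order all_algebra.
From mathcomp Require Export all_classical all_reals all_analysis.
Set Implicit Arguments.
Unset Strict Implicit.
Unset Printing Implicit Defensive.
Export Order.TTheory GRing.Theory Num.Theory.
Export numFieldNormedType.Exports.
Global Open Scope classical_set_scope.
Global Open Scope ring_scope.

(** * Lebesgue null sets of R^n
    The library has Lebesgue measure on R only, so the outer measure on R^n is
    defined here, as the infimum of the total volumes of countable covers by
    closed boxes.  Boxes may be degenerate, so finite covers are included.
    Meaningful for 0 < n only (for n = 0 every box is a point of volume 1). *)

Definition box (R : realType) (n : nat) (a b : 'rV[R]_n) : set 'rV[R]_n :=
  [set x | forall i, a ord0 i <= x ord0 i <= b ord0 i].

Definition box_volume (R : realType) (n : nat) (a b : 'rV[R]_n) : R :=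
  \prod_(i < n) (b ord0 i - a ord0 i).

Definition box_cover (R : realType) (n : nat) (A : set 'rV[R]_n)
    (c : nat -> 'rV[R]_n * 'rV[R]_n) : Prop :=
  (forall k i, (c k).1 ord0 i <= (c k).2 ord0 i) /\
  A `<=` \bigcup_k box (c k).1 (c k).2.

Definition lebesgue_outer_measure (R : realType) (n : nat)
    (A : set 'rV[R]_n) : \bar R :=
  ereal_inf [set (\sum_(0 <= k <oo) (box_volume (c k).1 (c k).2)%:E)%E
            | c in box_cover A].

Definition almost_all (R : realType) (n : nat) (P : 'rV[R]_n -> Prop) : Prop :=
  lebesgue_outer_measure [set x | ~ P x] = 0%E.

(** * Differential notions *)

Definition continuously_differentiable (R : realType) (m n : nat)
    (f : 'rV[R]_m -> 'rV[R]_n) : Prop :=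
  (forall x, differentiable f x) /\ continuous (fun x => 'J f x).

(** [F] is given on the whole space by a formula and considered on [D], which
    need not be open; its derivative at a point of [D] is that of the formula
    in the ambient space.  Differentiability is required explicitly since ['d]
    is a total operator. *)
Definition regular_value (R : realType) (V W : normedModType R) (D : set V)
    (F : V -> W) (y : W) : Prop :=
  forall p, D p -> F p = y ->
    differentiable F p /\ range ('d F p) = [set: W].

Definition ico0 (R : realType) (a : \bar R) : set R :=
  [set t : R | 0 <= t /\ (t%:E < a)%E].

(** [g'] is the derivative of [g] relative to [D]; for [D = [0, a)] this is the
    right derivative at 0 and the two-sided one elsewhere. *)
Definition has_derivative_within (R : realType) (V : normedModType R)
    (D : set R) (g g' : R -> V) : Prop :=
  forall t, D t ->
    (fun s => (s - t)^-1 *: (g s - g t)) @ within D t^' --> g' t.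

Definition smooth_curve_from (R : realType) (V : normedModType R) (X : set V)
    (q : V) (Gamma : set V) : Prop :=
  exists (a : \bar R) (g g' : R -> V),
    [/\ (0 < a)%E, g @` ico0 a `<=` X, g 0 = q & Gamma = g @` ico0 a] /\
    [/\ has_derivative_within (ico0 a) g g',
        {within ico0 a, continuous g'} &
        forall t, ico0 a t -> g' t != 0].

(** * The homotopy *)

Definition phi (R : realType) (t : R) : R := t ^+ 3.

Definition psi (R : realType) (n : nat) (f : 'rV[R]_n -> 'rV[R]_n)
    (x : 'rV[R]_n) : 'rV[R]_n :=
  \row_i (phi ((f x ord0 i - x ord0 i) ^+ 2)
          - phi (f x ord0 i * `|f x ord0 i|)
          - phi (x ord0 i * `|x ord0 i|)).

Definition homotopy_map (R : realType) (n : nat) (f : 'rV[R]_n -> 'rV[R]_n)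
    (x0 : 'rV[R]_n) (p : 'rV[R]_n * 'rV[R]_n) : 'rV[R]_n :=
  \row_i (psi f p.1 ord0 i - p.2 ord0 i * psi f x0 ord0 i).

Definition homotopy_domain (R : realType) (n : nat) :
    set ('rV[R]_n * 'rV[R]_n) :=
  [set p : 'rV[R]_n * 'rV[R]_n | forall i, 0 < p.2 ord0 i <= 1].

Definition zero_point_set (R : realType) (n : nat) (f : 'rV[R]_n -> 'rV[R]_n)
    (x0 : 'rV[R]_n) : set ('rV[R]_n * 'rV[R]_n) :=
  [set p | homotopy_domain p /\ homotopy_map f x0 p = 0].

(* Main.v *)
Require Import Defs.
From mathcomp Require Import ring lra.
Set Implicit Arguments.
Unset Strict Implicit.
Unset Printing Implicit Defensive.

(** No exceptional null set is needed: the conclusion holds at every [x0] with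
    all [psi_i(x0)] nonzero and a nonsingular Jacobian.  The partial derivative
    of the homotopy in [lambda] is the invertible matrix [- diag(psi_i(x0))],
    whence regularity.  The zero set is the graph of
    [lambda_i = psi_i(x) / psi_i(x0)] over the [x]-space, so any curve in [x]
    lifts to it; the implicit function theorem is not needed.  We lift the
    segment [x(t) = x0 + t v], where [v] is the Newton direction, sent to
    [- psi(x0)] by the Jacobian: then every [lambda_i] starts at 1 with
    derivative -1, hence stays in (0, 1] for a short time.  The lift is C^1
    because [t |-> t |t|] is. *)

(** * Null sets *)

Lemma almost_allT (R : realType) (n : nat) (P : 'rV[R]_n -> Prop) :
  (0 < n)%N -> (forall x, P x) -> almost_all P.
Proof.
move=> n0 HP; rewrite /almost_all /lebesgue_outer_measure.
apply/eqP; rewrite eq_le; apply/andP; split.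
(* The exceptional set is empty, so boxes reduced to the origin cover it. As [0 < n], their volume
   is a product with at least one factor, hence 0. *)
- apply: ereal_inf_lbound; exists (fun=> (0, 0)).
    by split=> [k i|x /= []//]; rewrite /= lexx.
  apply: eseries0 => k _ _; rewrite /box_volume /=.
  by rewrite (bigD1 (Ordinal n0)) //= subrr mul0r.
- apply: le_ereal_inf_tmp => _ [c [c_le _] <-].
  apply: nneseries_ge0 => k _ _; rewrite lee_fin.
  by apply: prodr_ge0 => i _; rewrite subr_ge0.
Qed.

(** * Coordinatewise calculus and the derivative of [t |t|] *)

Lemma cvg_mx (K : realFieldType) (m n : nat) (T : Type) (F : set_system T)
    {FF : Filter F} (M : T -> 'M[K]_(m, n)) (L : 'M[K]_(m, n)) :
  (forall i j, M x i j @[x --> F] --> L i j) -> M @ F --> L.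
Proof.
move=> ML; apply/cvgrPdist_le => e e0; near=> x.
rewrite /Num.Def.normr/= mx_normrE (bigmax_le _ (ltW e0))//= => i _.
rewrite !mxE/=.
move: i; near: x; apply: filter_forall => /= i.
exact: ((cvgrPdist_le _ _).1 (ML i.1 i.2)).
Unshelve. all: by end_near. Qed.

Lemma differentiable_rV (R : numFieldType) (V : normedModType R) (n : nat)
    (f : V -> 'rV[R]_n) (x : V) :
  (forall i, differentiable (fun y => f y ord0 i) x) -> differentiable f x.
Proof.
move=> df.
rewrite (_ : f = \sum_(i < n) (fun y => f y ord0 i *: delta_mx ord0 i)).
  by apply: differentiable_sum => i; exact/differentiableZl.
by apply/funext => y; rewrite fct_sumE {1}[f y]row_sum_delta.
Qed.

Lemma is_derive_mulr_norm (R : realType) (u : R) :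
  is_derive u 1 (fun x => x * `|x|) (2 * `|u|).
Proof.
suff H : (h^-1 *: (((fun x => x * `|x|) \o shift u) (h *: 1) - u * `|u|))
    @[h --> 0^'] --> 2 * `|u|.
  by apply: DeriveDef; [apply/cvg_ex; exists (2 * `|u|)|exact: cvg_lim H].
apply/cvgrPdist_le => e e0; near=> h.
have h0 : h != 0 by near: h; exact: nbhs_dnbhs_neq.
apply: (@le_trans _ _ `|h|); last by near: h; exact: dnbhs0_le.
rewrite /= [h%:A]mulr1 [_ *: _]mulrC.
have -> : 2 * `|u| - ((h + u) * `|h + u| - u * `|u|) / h =
   (2 * `|u| * h - ((h + u) * `|h + u| - u * `|u|)) / h by field.
(* The derivative [2 |u|] is 2-Lipschitz, so the remainder is at most [h ^+ 2]. *)
rewrite normrM normfV ler_pdivrMr ?normr_gt0// -normrM -expr2.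
rewrite [leRHS]ger0_norm ?sqr_ge0//.
rewrite ler_norml.
by case: (ger0P u) => u0; case: (ger0P (h + u)) => hu; apply/andP; split; nra.
Unshelve. all: by end_near. Qed.

(** * Scalar C^1 functions and the smoothness of [psi] *)

Definition C1 (R : realType) (V : normedModType R) (h : V -> R) :=
  (forall x, differentiable h x) /\ forall v, continuous ('D_v h).

Lemma C1B (R : realType) (V : normedModType R) (g h : V -> R) :
  C1 g -> C1 h -> C1 (g \- h).
Proof.
move=> [dg cg] [dh ch]; split=> [x|v]; first exact: differentiableB.
rewrite (_ : 'D_v _ = 'D_v g \- 'D_v h).
  by move=> x; apply: cvgB; [exact: cg|exact: ch].
by apply/funext => x; rewrite deriveB//; exact: diff_derivable.
Qed.

Lemma C1M (R : realType) (V : normedModType R) (g h : V -> R) :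
  C1 g -> C1 h -> C1 (g \* h).
Proof.
move=> [dg cg] [dh ch]; split=> [x|v]; first exact: differentiableM.
rewrite (_ : 'D_v _ = (g \* 'D_v h) \+ (h \* 'D_v g)).
  move=> x; apply: cvgD; apply: cvgM.
  - exact: differentiable_continuous.
  - exact: ch.
  - exact: differentiable_continuous.
  - exact: cg.
by apply/funext => x; rewrite deriveM//; exact: diff_derivable.
Qed.

(** The norm has a kink at 0, so [C1M] does not apply where [h] vanishes. Instead the chain rule is
    used with [y |y|], whose derivative [2 |y|] is continuous. *)
Lemma C1_mulr_norm (R : realType) (V : normedModType R) (h : V -> R) :
  C1 h -> C1 (fun x => h x * `|h x|).
Proof.
move=> [dh ch].
pose q (y : R) := y * `|y|.
have dq y : differentiable q y.
  by apply/derivable1_diffP; case: (is_derive_mulr_norm y).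
have dqh x : differentiable (q \o h) x by exact: differentiable_comp.
split; first exact: dqh.
move=> v; rewrite (_ : 'D_v _ = (fun x => 'D_v h x * (2 * `|h x|))).
  move=> x; apply: cvgM; first exact: ch.
  apply: cvgM; first exact: cvg_cst.
  by apply: cvg_norm; exact: differentiable_continuous.
apply/funext => x; rewrite (deriveE _ (dqh x)) diff_comp//=.
rewrite deriv1E; last exact/derivable1_diffP.
by rewrite deriveE// derive1E (@derive_val _ _ _ _ _ _ _ (is_derive_mulr_norm (h x))).
Qed.

(** For fixed [v], the directional derivative is a linear combination of Jacobian entries. [C1] uses
    directional derivatives because sum and product rules apply to them directly; the way back is
    [continuously_differentiable_rV]. *)
Lemma C1_coord (R : realType) (m n : nat) (f : 'rV[R]_m -> 'rV[R]_n) (i : 'I_n) :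
  continuously_differentiable f -> C1 (fun x => f x ord0 i).
Proof.
move=> [df cJ]; split=> [x|v].
  exact: (differentiable_comp (df x) (differentiable_coord (f x) ord0 i)).
rewrite (_ : 'D_v _ = (fun x => \sum_j v ord0 j * 'J f x j i)).
  move=> x.
  apply: (@cvg_big _ _ _ _ _ add_continuous _ (nbhs x) _ _ _ (nbhs_filter x)) => j _.
  apply: cvgMl_tmp.
  apply: (@continuous_comp _ _ _ (fun y => 'J f y) (fun M => M j i)).
    exact: cJ.
  exact: coord_continuous.
apply/funext => x.
have := deriveEjacobian v (df x); rewrite derive_mx; last exact: diff_derivable.
by move=> /(congr1 (fun M : 'rV[R]_n => M ord0 i)); rewrite !mxE.
Qed.

(** Each Jacobian entry is the derivative of one component along a basis vector. *)
Lemma continuously_differentiable_rV (R : realType) (m n : nat)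
    (f : 'rV[R]_m -> 'rV[R]_n) :
  (forall i, C1 (fun x => f x ord0 i)) -> continuously_differentiable f.
Proof.
move=> cf.
have df x : differentiable f x.
  by apply: differentiable_rV => i; have [+ _] := cf i; exact.
split=> // x; apply: (@cvg_mx _ _ _ _ _ (nbhs_filter x)) => i j.
have JE y : 'J f y i j = 'D_(delta_mx ord0 i) (fun x => f x ord0 j) y.
  rewrite /jacobian mxE -deriveE// derive_mx ?mxE//; exact: diff_derivable.
under eq_fun do rewrite JE; rewrite JE.
by have [_ +] := cf j; apply.
Qed.

Lemma continuously_differentiable_psi (R : realType) (n : nat)
    (f : 'rV[R]_n -> 'rV[R]_n) :
  continuously_differentiable f -> continuously_differentiable (psi f).
Proof.
move=> hf; apply: continuously_differentiable_rV => i.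
have C1id : C1 (fun x : 'rV[R]_n => x ord0 i).
  (* Coordinates are the components of the identity, whose Jacobian is constantly the identity
     matrix. *)
  apply: (@C1_coord _ _ _ id); split=> [x|]; first exact/ex_diff.
  rewrite (_ : jacobian _ = cst 1%:M); first exact: cst_continuous.
  apply/funext => x; apply/row_matrixP => j.
  by rewrite rowE /jacobian mul_rV_lin1 diff_val row1.
have C1f := C1_coord i hf.
have C1phi h : C1 h -> C1 (fun x : 'rV[R]_n => phi (h x)).
  by move=> C1h; exact: (C1M C1h (C1M C1h C1h)).
have C1uf := C1B C1f C1id.
under eq_fun do rewrite mxE.
by apply: C1B; [apply: C1B|]; apply: C1phi;
  [exact: (C1M C1uf C1uf)|exact: C1_mulr_norm|exact: C1_mulr_norm].
Qed.

(** * Regularity of the homotopy *)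

Lemma regular_value_homotopy_map (R : realType) (n : nat)
    (f : 'rV[R]_n -> 'rV[R]_n) (x0 : 'rV[R]_n)
    (D : set ('rV[R]_n * 'rV[R]_n)) (y : 'rV[R]_n) :
  (forall x, differentiable (psi f) x) -> (forall i, psi f x0 ord0 i != 0) ->
  regular_value D (homotopy_map f x0) y.
Proof.
move=> dpsi psi0 p _ _.
have dfst : differentiable (fst : 'rV[R]_n * 'rV[R]_n -> 'rV[R]_n) p.
  by apply: linear_differentiable => q; exact: cvg_fst.
have dsnd : differentiable (snd : 'rV[R]_n * 'rV[R]_n -> 'rV[R]_n) p.
  by apply: linear_differentiable => q; exact: cvg_snd.
have dcoord (q : 'rV[R]_n) (i : 'I_n) := differentiable_coord q ord0 i.
have dH : differentiable (homotopy_map f x0) p.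
  apply: differentiable_rV => i; under eq_fun do rewrite mxE.
  apply: differentiableB.
    exact: (differentiable_comp (differentiable_comp dfst (dpsi p.1)) (dcoord _ i)).
  apply: differentiableM; last exact: differentiable_cst.
  exact: (differentiable_comp dsnd (dcoord _ i)).
split=> //; apply/seteqP; split=> // z _.
(* To reach [z], move in [lambda] only. The homotopy is affine in [lambda], so the difference
   quotient equals [z] for every [h != 0]. *)
exists (0, \row_i (- (z ord0 i / psi f x0 ord0 i))) => //.
rewrite -deriveE//; apply: cvg_lim => //; apply: cvg_near_cst; near=> h.
have h0 : h != 0 by near: h; exact: nbhs_dnbhs_neq.
rewrite /homotopy_map /= scaler0 add0r; apply/rowP => i.
move: (psi f x0) (psi f p.1) (psi0 i) => c a ci0.
by rewrite !mxE; field; rewrite h0 ci0.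
Unshelve. all: by end_near. Qed.

(** * Derivatives along curves *)

Lemma is_derive_has_derivative_within (R : realType) (V : normedModType R)
    (D : set R) (g g' : R -> V) :
  (forall t : R, is_derive t 1 g (g' t)) -> has_derivative_within D g g'.
Proof.
move=> dg t _; apply: cvg_within_filter.
have [dgt <-] := dg t.
(* Substitute [h = s - t], which tends to 0 through nonzero values. *)
rewrite (_ : (fun s => _) =
  (fun h => h^-1 *: ((g \o shift t) (h *: 1) - g t)) \o (fun s => s - t)); last first.
  by apply/funext => s /=; rewrite [_%:A]mulr1 subrK.
apply: cvg_comp dgt => A /nbhs_ballP[e /= e0 eA]; apply/nbhs_ballP.
exists e => //= s; rewrite -ball_normE /= => tse st; apply: eA.
  by rewrite -ball_normE /= sub0r opprB.
by rewrite subr_eq0.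
Qed.

(** Both derivatives are limits of the same function of [h]. *)
Lemma is_derive_line (R : realType) (V W : normedModType R) (f : V -> W)
    (a v : V) (t : R) (df : W) :
  is_derive (a + t *: v) v f df ->
  is_derive t 1 (fun s => f (a + s *: v)) df.
Proof.
have E : (fun h : R => h^-1 *: (((fun s => f (a + s *: v)) \o shift t) (h *: 1)
    - f (a + t *: v))) =
    (fun h => h^-1 *: ((f \o shift (a + t *: v)) (h *: v) - f (a + t *: v))).
  by apply/funext => h /=; rewrite [_%:A]mulr1 scalerDl addrCA.
by case=> [dfv dfE]; apply: DeriveDef; rewrite /derivable /derive /= E.
Qed.

Lemma has_derivative_within_pair (R : realType) (V W : normedModType R)
    (D : set R) (g g' : R -> V) (h h' : R -> W) :
  has_derivative_within D g g' -> has_derivative_within D h h' ->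
  has_derivative_within D (fun t => (g t, h t)) (fun t => (g' t, h' t)).
Proof. by move=> dg dh t Dt; exact: cvg_pair (dg t Dt) (dh t Dt). Qed.

Lemma has_derivative_within_rV (R : realType) (n : nat) (D : set R)
    (g g' : R -> 'rV[R]_n) :
  (forall i, has_derivative_within D (fun t => g t ord0 i : R)
                                     (fun t => g' t ord0 i)) ->
  has_derivative_within D g g'.
Proof.
move=> dg t Dt; apply: cvg_mx => i j; rewrite ord1.
by under eq_fun do rewrite !mxE; exact: dg.
Qed.

(** Difference quotients with a negative limit are eventually negative, and for [t < s] the
    denominator is positive. *)
Lemma near_lt_derive_lt0 (R : realType) (h : R -> R) (t d : R) :
  is_derive t 1 h d -> d < 0 -> \forall s \near t, t < s -> h s < h t.
Proof.
move=> dh d0.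
have [dht dE] := dh.
have : \forall e \near 0^', e^-1 *: ((h \o shift t) (e *: 1) - h t) < 0.
  by apply: (cvgr_lt _ dht); rewrite -[X in X < 0]/('D_1 h t) dE.
move=> /nbhs_ballP[e /= e0 He]; apply/nbhs_ballP; exists e => //= s.
rewrite -ball_normE /= => tse ts.
have st0 : 0 < s - t by rewrite subr_gt0.
have := He (s - t); rewrite -ball_normE /= sub0r opprB gt_eqF// [_%:A]mulr1 subrK.
by rewrite pmulr_rlt0 ?invr_gt0// subr_lt0; apply.
Qed.

(** * Lifting a segment to the zero set *)

Lemma graph_smooth_curve (R : realType) (n : nat) (hn : (0 < n)%N)
    (F : 'rV[R]_n -> 'rV[R]_n) (x0 : 'rV[R]_n) :
  continuously_differentiable F -> (forall i, F x0 ord0 i != 0) ->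
  'J F x0 \in unitmx ->
  exists Gamma : set ('rV[R]_n * 'rV[R]_n),
    smooth_curve_from (@homotopy_domain R n) (x0, const_mx 1) Gamma /\
    forall p, Gamma p -> forall i, F p.1 ord0 i = p.2 ord0 i * F x0 ord0 i.
Proof.
move=> C1F F0 unitJ.
have C1Fi i : C1 (fun x => F x ord0 i) by exact: C1_coord.
(* Row vectors multiply the Jacobian from the left: [v *m 'J F x0 = - F x0]. *)
pose v := - F x0 *m invmx ('J F x0).
pose x t := x0 + t *: v.
pose l t := \row_i ((F x0 ord0 i)^-1 * F (x t) ord0 i).
pose l' t := \row_i ((F x0 ord0 i)^-1 * 'D_v (fun y => F y ord0 i) (x t)).
have xc : continuous x.
  move=> t; apply: cvgD; first exact: cvg_cst.
  by apply: cvgZr_tmp; exact: cvg_id.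
have v0 : v != 0.
  (* If [v] were 0, then [F x0 = - (v *m 'J F x0)] would vanish, against its nonzero coordinate of
     index 0. *)
  apply/eqP => v0; have /eqP[] := F0 (Ordinal hn).
  rewrite -[F x0](mulmxKV unitJ) -[F x0]opprK mulNmx.
  by rewrite -/v v0 oppr0 mul0mx mxE.
have dx (t : R) : is_derive t 1 x v.
  apply: is_derive_line (fun y : 'rV[R]_n => y) _ _ _ _ _.
have dl i (t : R) : is_derive t 1 (fun s => l s ord0 i) (l' t ord0 i).
  under eq_fun do rewrite mxE; rewrite mxE.
  apply: is_deriveZ.
  apply: is_derive_line (fun y => F y ord0 i) _ _ _ _ _.
  apply: derivableP; apply: diff_derivable; have [+ _] := C1Fi i; exact.
have l'0 i : l' 0 ord0 i = -1.
  rewrite mxE /x scale0r addr0.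
  have [dF _] := C1F.
  have := deriveEjacobian v (dF x0); rewrite derive_mx; last exact: diff_derivable.
  rewrite mulmxKV// => /(congr1 (fun M : 'rV[R]_n => M ord0 i)); rewrite !mxE => ->.
  by rewrite mulrN mulVf.
have x00 : x 0 = x0 by rewrite /x scale0r addr0.
have l0 : l 0 = const_mx 1 by apply/rowP => i; rewrite !mxE x00 mulVf.
(* Positivity near 0 follows from continuity and [l 0 = 1]. The bound by 1 is an equality at [t = 0]
   and follows from the derivative -1 for small [t > 0]. *)
have [e e0 He] : exists2 e : R, 0 < e &
    forall t, 0 <= t < e -> forall i, 0 < l t ord0 i <= 1.
  have : \forall t \near (0 : R), 0 <= t -> forall i, 0 < l t ord0 i <= 1.
    have l_gt0 : \forall t \near (0 : R), forall i, 0 < l t ord0 i.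
      apply: (@filter_forall _ _ _ _ (nbhs_filter (0 : R))) => i.
      have cl : {for 0, continuous (fun t => l t ord0 i)}.
        by apply/differentiable_continuous/derivable1_diffP; case: (dl i 0).
      by apply: (cvgr_gt _ cl); rewrite l0 mxE.
    have l_lt : \forall t \near (0 : R), forall i, 0 < t -> l t ord0 i < l 0 ord0 i.
      apply: (@filter_forall _ _ _ _ (nbhs_filter (0 : R))) => i.
      apply: near_lt_derive_lt0 (dl i 0) _.
      by rewrite l'0 ltrN10.
    near=> t => t0 i; apply/andP; split; first by move: i; near: t.
    have <- : l 0 ord0 i = 1 by rewrite l0 mxE.
    move: t0; rewrite le_eqVlt => /predU1P[<-//|t0].
    by apply/ltW; move: i t0; near: t.
  move=> /nbhs_ballP[e /= e0 He]; exists e => // t /andP[t0 te].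
  by apply: He => //; rewrite -ball_normE /= sub0r normrN ger0_norm.
exists ((fun t => (x t, l t)) @` ico0 e%:E); split; last first.
  by move=> _ [t _ <-] i /=; rewrite mxE mulrC mulVKf.
exists e%:E, (fun t => (x t, l t)), (fun t => (v, l' t)); split; split.
- by rewrite lte_fin.
- by move=> _ [t [t0 te] <-] i; apply: He; rewrite t0 -lte_fin.
- by rewrite x00 l0.
- by [].
- apply: has_derivative_within_pair.
    by apply: is_derive_has_derivative_within.
  apply: has_derivative_within_rV => i.
  by apply: is_derive_has_derivative_within.
- apply: continuous_subspaceT => t.
  apply: (@cvg_pair _ _ _ (nbhs t) (nbhs v) (nbhs (l' t)) _ _ _ (fun=> v) l').
    exact: (@cvg_cst _ v).
  apply: cvg_mx => i j; rewrite ord1.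
  under eq_fun do rewrite mxE; rewrite mxE; apply: cvgMl_tmp.
  have [_ cD] := C1Fi j.
  exact: (@continuous_comp _ _ _ x ('D_v (fun y => F y ord0 j)) t (xc t) (cD v _)).
(* The first component of the velocity is the constant [v != 0]. *)
- by move=> t _; apply: contra_neq v0 => -[].
Unshelve. all: by end_near. Qed.

Theorem theorem3 (R : realType) (n : nat) (hn : (0 < n)%N)
    (f : 'rV[R]_n -> 'rV[R]_n) (hf : continuously_differentiable f) :
  almost_all (fun x0 : 'rV[R]_n =>
    (forall i, psi f x0 ord0 i != 0) ->
    'J (psi f) x0 \in unitmx ->
    regular_value (@homotopy_domain R n) (homotopy_map f x0) 0 /\
    exists Gamma : set ('rV[R]_n * 'rV[R]_n),
      smooth_curve_from (@homotopy_domain R n) (x0, const_mx 1) Gamma /\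
      Gamma `<=` zero_point_set f x0).
Proof.
apply: almost_allT => // x0 psi0 unitJ.
have C1psi := continuously_differentiable_psi hf.
split; first by apply: regular_value_homotopy_map => //; case: C1psi.
have [Gamma [curve zero]] := graph_smooth_curve hn C1psi psi0 unitJ.
exists Gamma; split=> // p Gp; split.
  (* The range condition on [lambda] is part of [smooth_curve_from]; the equation comes from
     [zero]. *)
  by have [a [g [g' [[_ + _ gE] _]]]] := curve; apply; rewrite -gE.
by apply/rowP => i; rewrite mxE (zero p Gp) subrr mxE.
Qed.
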